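(* For every integer $n\geq 7$ there exists a finite, simple, connected graph $G$ on $n$ vertices, with graph distance matrix $D\in\mathbb{R}^{n\times n}$, such that the linear system $Dx=\mathbbm{1}$ has no solution $x\in\mathbb{R}^n$.
   Context: For a finite, simple, connected graph $G$ with vertices $v_1,\dots,v_n$, the graph distance matrix is $D\in\mathbb{R}^{n\times n}$ with $D_{ij}=d(v_i,v_j)$, the shortest-path distance. $\mathbbm{1}=(1,1,\dots,1)^T$ denotes the all-ones column vector in $\mathbb{R}^n$. *)

(* Defs.v *)
From mathcomp Require Import all_boot all_order all_algebra.
From mathcomp Require Import reals.

Set Implicit Arguments.
Unset Strict Implicit.
Unset Printing Implicit Defensive.

Import GRing.Theory.
Local Open Scope ring_scope.

Record sgraph (T : finType) := SGraph {
  adj :> rel T;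
  adj_sym : symmetric adj;
  adj_irr : irreflexive adj
}.

Definition connected_graph (T : finType) (G : sgraph T) : Prop :=
  forall x y : T, connect G x y.

Definition has_walk (T : finType) (G : sgraph T) (x y : T) (k : nat) : bool :=
  [exists p : k.-tuple T, path G x p && (last x p == y)].

(* The least length of a walk from x to y. A shortest walk repeats no vertex,
   so searching the lengths below #|T| loses nothing (see gdist_walk and
   gdist_min); when y is unreachable from x the junk value is #|T|. *)
Definition gdist (T : finType) (G : sgraph T) (x y : T) : nat :=
  find (has_walk G x y) (iota 0 #|T|).

Definition dist_mx (R : realType) (n : nat) (G : sgraph 'I_n) : 'M[R]_n :=
  \matrix_(i, j) (gdist G i j)%:R.

Lemma has_walkP (T : finType) (G : sgraph T) (x y : T) (k : nat) :
  reflect (exists p : seq T, [/\ size p = k, path G x p & last x p = y])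
          (has_walk G x y k).
Proof.
apply: (iffP existsP) => [[p /andP[Gp /eqP yE]]|[p [sp Gp yE]]].
  by exists p; rewrite size_tuple.
by move/eqP: sp => sp; exists (Tuple sp); rewrite /= Gp yE eqxx.
Qed.

Lemma gdist_walk (T : finType) (G : sgraph T) (x y : T) :
  connect G x y ->
  exists p : seq T, [/\ size p = gdist G x y, path G x p & last x p = y].
Proof.
move=> /connectP[p0 Gp0 ->]; case/shortenP: Gp0 => p Gp Up _.
apply/has_walkP; set y' := last x p.
have hasw : has (has_walk G x y') (iota 0 #|T|).
  apply/hasP; exists (size p); last by apply/has_walkP; exists p.
  rewrite mem_iota /= add0n.
  by have := card_uniqP Up => /= <-; exact: max_card.
have := nth_find 0%N hasw; rewrite nth_iota ?add0n //.
by move: hasw; rewrite has_find size_iota.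
Qed.

Lemma gdist_min (T : finType) (G : sgraph T) (x : T) (p : seq T) :
  path G x p -> (gdist G x (last x p) <= size p)%N.
Proof.
move=> Gp; rewrite leqNgt; apply/negP => lt_p.
have := before_find 0%N lt_p; rewrite nth_iota ?add0n; last first.
  by apply: leq_trans lt_p _; rewrite -[X in (_ <= X)%N](size_iota 0) find_size.
by move/has_walkP; apply; exists p.
Qed.

(* Main.v *)
Require Import Defs.
From mathcomp Require Import all_boot all_order all_algebra.
From mathcomp Require Import reals.
From mathcomp Require Import ring.

Set Implicit Arguments.
Unset Strict Implicit.
Unset Printing Implicit Defensive.

Import GRing.Theory.
Local Open Scope ring_scope.

(** The system D x = 1 is unsolvable as soon as some row vector y satisfies
    y D = 0 while the entries of y have a nonzero sum: multiplying D x = 1 by y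
    on the left would give 0 = sum of y (lemma [left_kernel_unsolvable]).

    In a graph with a dominating vertex all distances are at most 2
    ([gdist_dominating]), so D = J - I + C, where J is the all-ones matrix and
    C is the adjacency matrix of the complement.  For y of sum 1 the condition
    y D = 0 then says that, at every vertex v,

      y_v = 1 + (sum of y over the vertices not adjacent to v).

    On 7 vertices this is solved by the complete multipartite graph
    K_(1,1,1,1,3): its complement is a triangle plus four isolated vertices,
    and y is 1 at the isolated vertices and -1 on the triangle, of sum
    4 - 3 = 1.

    A solution extends to more vertices by giving them weight 0.  They do not
    disturb the condition at the old vertices, and their own condition only
    asks that the weights of their non-neighbours add up to -1.  So it suffices
    to make each new vertex non-adjacent to one single triangle vertex. *)

Lemma left_kernel_unsolvable (R : nzRingType) (n : nat) (D : 'M[R]_n)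
    (y : 'rV[R]_n) :
  y *m D = 0 -> \sum_i y 0 i != 0 ->
  ~ (exists x : 'cV[R]_n, D *m x = const_mx 1).
Proof.
move=> yD0 /eqP sum_y [x Dx1]; apply: sum_y.
have : (y *m (D *m x)) 0 0 = 0 by rewrite mulmxA yD0 mul0mx mxE.
by rewrite Dx1 mxE; under eq_bigr do rewrite mxE mulr1.
Qed.

Section DominatingVertex.

Variables (T : finType) (G : sgraph T) (u : T).
Hypothesis u_dom : forall v, v != u -> G u v.

Lemma connected_dominating : connected_graph G.
Proof.
have u_conn v : connect G u v.
  by have [->|/u_dom /connect1] := eqVneq v u.
move=> x y; apply: connect_trans (u_conn y).
by rewrite (sym_connect_sym (@adj_sym _ G)).
Qed.

(** Two distinct non-adjacent vertices are both different from the dominating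
    vertex, hence joined by a walk of length 2 through it. *)
Lemma gdist_dominating x y :
  gdist G x y = if x == y then 0%N else if G x y then 1%N else 2%N.
Proof.
have [<-|neq_xy] := eqVneq x y.
  by apply/eqP; rewrite -leqn0; apply: (@gdist_min _ G x [::]).
have [p [sp Gp yE]] := gdist_walk (connected_dominating x y).
case: ifP => Gxy; apply/eqP; rewrite eqn_leq.
  have -> /= : (gdist G x y <= 1)%N.
    by apply: (@gdist_min _ G x [:: y]); rewrite /= Gxy.
  by rewrite -sp; case: p yE {sp Gp} => // /eqP; rewrite (negPf neq_xy).
have x_neq_u : x != u.
  by apply: contraFneq Gxy => xu; rewrite xu u_dom // -xu eq_sym.
have y_neq_u : y != u.
  by apply: contraFneq Gxy => yu; rewrite adj_sym yu u_dom // -yu.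
have -> /= : (gdist G x y <= 2)%N.
  apply: (@gdist_min _ G x [:: u; y]).
  by rewrite /= adj_sym !u_dom.
rewrite -sp; case: p Gp yE {sp} => [_ /eqP|z [|//] /andP[Gxz _] /= zE].
  by rewrite (negPf neq_xy).
by rewrite -zE Gxz in Gxy.
Qed.

End DominatingVertex.

(** The complement of the graph: a triangle on 4, 5, 6, the vertices from 7 on
    as pendant neighbours of 4, and 0 to 3 isolated. *)
Definition nonadj (i j : nat) : bool :=
  [&& i != j, 3 < minn i j & (minn i j == 4) || (maxn i j < 7)]%N.

Section Witness.

Variable n : nat.

Definition witness_adj : rel 'I_n :=
  fun i j => (i != j) && ~~ nonadj i j.

Lemma witness_adj_sym : symmetric witness_adj.
Proof.
by move=> i j; rewrite /witness_adj /nonadj minnC maxnC -(inj_eq val_inj) eq_sym.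
Qed.

Lemma witness_adj_irr : irreflexive witness_adj.
Proof. by move=> i; rewrite /witness_adj eqxx. Qed.

Definition witness : sgraph 'I_n := SGraph witness_adj_sym witness_adj_irr.

End Witness.

Definition weight (R : pzRingType) (i : nat) : R :=
  if (i < 4)%N then 1 else if (i < 7)%N then -1 else 0.

Lemma sum_weight (R : pzRingType) (m : nat) (F : nat -> R) :
  \sum_(i < m.+4.+3) weight R i * F i =
    F 0%N + F 1%N + F 2%N + F 3%N - F 4%N - F 5%N - F 6%N.
Proof.
do 7!rewrite big_ord_recl; rewrite big1 => [|i _]; last by rewrite mul0r.
by rewrite /weight /= !mul1r !mulN1r addr0 !addrA.
Qed.

Theorem theorem1 (R : realType) (n : nat) (hn : (7 <= n)%N) :
  exists G : sgraph 'I_n,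
    connected_graph G /\
    ~ (exists x : 'cV[R]_n, dist_mx R G *m x = const_mx 1).
Proof.
case: n hn => [|[|[|[|[|[|[|m]]]]]]] // _.
have dom0 v : v != ord0 -> witness m.+4.+3 ord0 v.
  by move=> v_neq0; rewrite /= /witness_adj /nonadj eq_sym v_neq0 min0n andbF.
exists (witness m.+4.+3); split; first exact: connected_dominating dom0.
apply: (@left_kernel_unsolvable _ _ _ (\row_i weight R i)); last first.
  under eq_bigr do rewrite mxE -[weight R _]mulr1.
  rewrite (sum_weight _ (fun=> 1)).
  have -> : 1 + 1 + 1 + 1 - 1 - 1 - 1 = 1 :> R by ring.
  exact: oner_neq0.
apply/rowP => j; rewrite !mxE.
pose d (i : nat) := if i == j then 0%N else if nonadj i j then 2%N else 1%N.
transitivity (\sum_(i < m.+4.+3) weight R i * (d i)%:R).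
  apply: eq_bigr => i _; rewrite !mxE (gdist_dominating dom0) /d.
  rewrite /= /witness_adj -(inj_eq val_inj) /=.
  by case: eqP => //= _; case: nonadj.
(* The weighted sum of the distances to j sees j only through its value if j
   is at most 6, and through j >= 7 otherwise: eight numerical identities, of
   the form 4 - 4 = 0, or 3 - 3 = 0 for j at most 3. *)
rewrite (sum_weight _ (fun i => (d i)%:R)) /d.
case: j {d} => [[|[|[|[|[|[|[|j]]]]]]] ltj] /=; rewrite /nonadj /=; ring.
Qed.
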